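(* Let $T_1,T_2\in \mathcal{L}_A(\mathcal{H})$. Then for every $n\in\mathbb{N}$ (i.e. every integer $n\ge 1$), $$w_{\mathbb{A}}\left(\begin{bmatrix} T_1 & T_2\\ -T_2 & -T_1\end{bmatrix}\right)\geq \left[\max\left\{w_A\left(((T_1-T_2)(T_1+T_2))^n\right),\ w_A\left(((T_1+T_2)(T_1-T_2))^n\right)\right\}\right]^{\frac{1}{2n}},$$ and $$w_{\mathbb{A}}\left(\begin{bmatrix} T_1 & T_2\\ -T_2 & -T_1\end{bmatrix}\right)\leq \frac{\max\{\|T_1+T_2\|_A,\ \|T_1-T_2\|_A\}}{2}+\frac{\left[\max\{\|(T_1+T_2)(T_1-T_2)\|_A,\ \|(T_1-T_2)(T_1+T_2)\|_A\}\right]^{\frac12}}{2}.$$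
   Context: $\mathcal{H}$ is a complex Hilbert space with inner product $\langle\cdot,\cdot\rangle$, and $\mathcal{L}(\mathcal{H})$ is the algebra of bounded linear operators on $\mathcal{H}$. $A\in\mathcal{L}(\mathcal{H})$ is a fixed positive operator, i.e. $A=A^*$ and $\langle Ax,x\rangle\ge 0$ for all $x\in\mathcal{H}$ ($A$ need not be injective). Put $\langle x,y\rangle_A=\langle Ax,y\rangle$ and $\|x\|_A=\sqrt{\langle x,x\rangle_A}$ (a seminorm). $\mathcal{R}(\cdot)$ denotes the range, and $\mathcal{L}_A(\mathcal{H})=\{T\in\mathcal{L}(\mathcal{H}):\mathcal{R}(T^*A)\subseteq\mathcal{R}(A)\}$ (the operators admitting an $A$-adjoint, i.e. an $X\in\mathcal{L}(\mathcal{H})$ with $AX=T^*A$); it is a subalgebra of $\mathcal{L}(\mathcal{H})$. For $T\in\mathcal{L}_A(\mathcal{H})$ the $A$-operator seminorm is $\|T\|_A=\sup\{\|Tx\|_A/\|x\|_A : x\in\overline{\mathcal{R}(A)},\ x\ne 0\}$, and the $A$-numerical radius is $w_A(T)=\sup\{|\langle Tx,x\rangle_A| : x\in\mathcal{H},\ \|x\|_A=1\}$. $\mathbb{A}=\begin{bmatrix} A&0\\0&A\end{bmatrix}$ is the positive diagonal operator on $\mathcal{H}\oplus\mathcal{H}$, and $w_{\mathbb{A}}$ is the numerical radius defined in the same way with $(\mathcal{H}\oplus\mathcal{H},\mathbb{A})$ in place of $(\mathcal{H},A)$. *)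

(* Defs.v *)
From HB Require Import structures.
From mathcomp Require Import all_boot all_order all_algebra.
From mathcomp Require Import sesquilinear complex.
From mathcomp Require Import all_classical all_reals all_analysis.
Set Implicit Arguments.
Unset Strict Implicit.
Unset Printing Implicit Defensive.

Import Order.TTheory GRing.Theory Num.Theory.
Import numFieldNormedType.Exports.
Local Open Scope classical_set_scope.
Local Open Scope ring_scope.

Notation inner_product V := {dot V for Num.conj}.

Section DirectSum.
Variables (R : realType) (V : lmodType R[i]) (ip : inner_product V).

Definition dsum_ip (u v : V * V) : R[i] := ip u.1 v.1 + ip u.2 v.2.

Let dsum_ip_bilinear :
  bilinear_for ( *%R : GRing.Scale.law _ _)
    (Num.conj \; *%R : GRing.Scale.law _ _) dsum_ip.
Proof.
split=> [v|u] a x y; rewrite /dsum_ip /=.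
- by rewrite !linearPl /= mulrDr addrACA.
- by rewrite !linearPr /= mulrDr addrACA.
Qed.

HB.instance Definition _ := bilinear_isBilinear.Build R[i] (V * V)%type
  (V * V)%type R[i] *%R (Num.conj \; *%R) dsum_ip dsum_ip_bilinear.

Let dsum_ip_hermitian (u v : V * V) :
  dsum_ip u v = (-1) ^+ false * Num.conj (dsum_ip v u).
Proof.
rewrite expr0 mul1r /dsum_ip rmorphD /=.
by congr (_ + _); rewrite [LHS](hermC ip) expr0 mul1r.
Qed.

HB.instance Definition _ := isHermitianSesquilinear.Build R[i] (V * V)%type
  false Num.conj dsum_ip dsum_ip_hermitian.

Let dsum_ip_gt0 (u : V * V) : u != 0 -> 0 < dsum_ip u u.
Proof.
case: u => u v; rewrite /dsum_ip -pair_eqE /= negb_and -!(dnorm_gt0 ip).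
by case/orP => h; [apply: ltr_wpDr|apply: ltr_wpDl].
Qed.

HB.instance Definition _ := isDotProduct.Build R[i] (V * V)%type
  dsum_ip dsum_ip_gt0.

End DirectSum.

Definition block_op (V : zmodType) (T11 T12 T21 T22 : V -> V) :
    V * V -> V * V :=
  fun u => (T11 u.1 + T12 u.2, T21 u.1 + T22 u.2).

Section SemiHilbert.
Variables (R : realType) (V : lmodType R[i]) (ip : inner_product V).
Implicit Types (A T Tstar : V -> V).

Definition is_adjoint T Tstar : Prop :=
  forall x y, ip (T x) y = ip x (Tstar y).

Definition positive_op A : Prop :=
  is_adjoint A A /\ forall x, 0 <= ip (A x) x.

Definition semi_ip A (x y : V) : R[i] := ip (A x) y.

Definition semi_norm A (x : V) : R := Num.sqrt (complex.Re (semi_ip A x x)).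

(* [sup] takes values in [R]: it is 0 on the empty set, which occurs for A = 0. *)
Definition num_radius A T : R :=
  sup [set complex.Re `|semi_ip A (T x) x| | x in [set x | semi_norm A x = 1]].

End SemiHilbert.

Section BoundedOperators.
Variables (R : realType) (H : normedModType R[i]) (ip : inner_product H).

Definition bounded_op (T : {linear H -> H}) : Prop :=
  bounded_near T (nbhs (0 : H)).

(* On a Hilbert space, [Tstar] exists and is unique by the Riesz theorem, so
   this says exactly that R(T* A) is included in R(A). *)
Definition LA (A : H -> H) (T : {linear H -> H}) : Prop :=
  bounded_op T /\
  exists2 Tstar : H -> H,
    is_adjoint ip T Tstar & range (Tstar \o A) `<=` range A.

Definition op_seminorm (A T : H -> H) : R :=
  sup [set semi_norm ip A (T x) / semi_norm ip A x
      | x in [set x | closure (range A) x /\ x != 0]].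

End BoundedOperators.

(* Main.v *)
Require Import Defs.
From HB Require Import structures.
From mathcomp Require Import all_boot all_order all_algebra.
From mathcomp Require Import ring lra.
From mathcomp Require Import cyclic separable cyclotomic sesquilinear complex.
From mathcomp Require Import all_classical all_reals all_analysis.
Set Implicit Arguments.
Unset Strict Implicit.
Unset Printing Implicit Defensive.
Import Order.TTheory GRing.Theory Num.Theory.
Import numFieldNormedType.Exports.
Local Open Scope classical_set_scope.
Local Open Scope ring_scope.

(* The substitution p = x + y, q = x - y turns the block operator T into
   (p, q) |-> (P q, Q p) with P = T1 - T2 and Q = T1 + T2, so T^2 acts as P Q on
   p and Q P on q.  The lower bound is then the power inequality
   w(T^(2n)) <= w(T)^(2n), proved by averaging over roots of unity (Pearcy);
   the upper bound is Kittaneh's w(T) <= (|T| + |T^2|^(1/2)) / 2.  Both only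
   use a positive semidefinite form and an adjoint for it.

   Since the suprema are junk on unbounded sets, operators in L_A(H) must first
   be shown bounded for the A-seminorm.  Uniform boundedness gives
   |A T x| <= C |A x|, and log-convexity of the moments <(X T)^m x, x>_A, X an
   A-adjoint of T, then bounds <X T x, x>_A = |T x|_A^2.  Finally, R(A) is dense
   in H for the A-seminorm, so that the supremum over the closure of R(A)
   controls |T x|_A for every x. *)

(** * Roots of unity and complex moduli *)

(* The library has this for algC only ([C_prim_root_exists]). *)
Lemma prim_root_exists (C : numClosedFieldType) n :
  (0 < n)%N -> exists z : C, n.-primitive_root z.
Proof.
move=> n_gt0; have [r] := closed_field_poly_normal ('X^n - 1 : {poly C}).
rewrite (monicP _) ?monicXnsubC// scale1r => Dp.
have rn1 : all n.-unity_root r.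
  by apply/allP => z; rewrite -root_prod_XsubC -Dp.
have sz_r : (n < (size r).+1)%N.
  by rewrite -(size_prod_XsubC r id) -Dp size_XnsubC.
have [|z] := hasP (has_prim_root n_gt0 rn1 _ sz_r); last by exists z.
by rewrite -separable_prod_XsubC -Dp separable_Xn_sub_1 // pnatr_eq0 -lt0n.
Qed.

Lemma sum_expr_root_unity (C : fieldType) n (z : C) :
  z ^+ n = 1 -> z != 1 -> \sum_(i < n) z ^+ i = 0.
Proof.
move=> zn1 z1; apply: (mulfI (x := z - 1)); first by rewrite subr_eq0.
by rewrite -subrX1 zn1 subrr mulr0.
Qed.

Section ComplexModulus.
Variable R : realType.
Implicit Types z : R[i].

(** The modulus as an element of [R]: the norm on [R[i]] takes its values in [R[i]]. *)
Definition cmod z : R := complex.Re `|z|.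

Lemma cmodE z : `|z| = (cmod z)%:C%C.
Proof. by rewrite /cmod RRe_real ?normr_real. Qed.

Lemma cmod_ge0 z : 0 <= cmod z.
Proof. by rewrite -ler0c -cmodE. Qed.

Lemma cmodM z1 z2 : cmod (z1 * z2) = cmod z1 * cmod z2.
Proof. by apply: complexI; rewrite rmorphM/= -!cmodE normrM. Qed.

Lemma cmodC (a : R) : cmod a%:C%C = `|a|.
Proof. by rewrite /cmod normc_def/= expr0n addr0 sqrtr_sqr. Qed.

Lemma cmod_conj z : cmod (Num.conj z) = cmod z.
Proof. by rewrite /cmod norm_conjC. Qed.

Lemma Re_le_cmod z : complex.Re z <= cmod z.
Proof.
by apply: le_trans (ler_norm _) _; rewrite -lecR -cmodE normc_ge_Re.
Qed.

Lemma cmod_sqr z : z * Num.conj z = (cmod z ^+ 2)%:C%C.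
Proof. by rewrite -normCK cmodE rmorphXn. Qed.

Lemma ReC (z : R[i]) (a : R) : complex.Re (a%:C%C * z) = a * complex.Re z.
Proof. by case: z => x y /=; rewrite mul0r subr0. Qed.

(** Rotating by such a phase turns bounds on real parts into bounds on moduli. *)
Lemma phase_exists z : exists c : R[i], cmod c = 1 /\ c * z = (cmod z)%:C%C.
Proof.
have [->|z0] := eqVneq z 0.
  by exists 1; rewrite mul1r /cmod normr1 normr0.
exists (`|z| / z); split; last by rewrite mulfVK// cmodE.
by rewrite /cmod normrM normfV normr_id divff ?normr_eq0.
Qed.

End ComplexModulus.

(** * Semi-inner products *)

Lemma discriminant_le (R : realFieldType) (a b r : R) : 0 <= a -> 0 <= b ->
  (forall t, 0 <= a ^+ 2 + t ^+ 2 * b ^+ 2 - 2 * (t * r)) -> r <= a * b.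
Proof.
move=> a0; rewrite le_eqVlt => /predU1P[<-|b0] sq.
  rewrite mulr0 leNgt; apply/negP => r0.
  (* For [b = 0] the hypothesis is affine in [t], and this [t] makes it negative. *)
  by have := sq ((a ^+ 2 + 1) / r); rewrite divfK ?gt_eqF//; nra.
(* The minimiser of the quadratic in [t]. *)
have := sq (r / b ^+ 2).
have -> : a ^+ 2 + (r / b ^+ 2) ^+ 2 * b ^+ 2 - 2 * (r / b ^+ 2 * r)
          = ((a * b) ^+ 2 - r ^+ 2) / b ^+ 2 by field; rewrite gt_eqF.
rewrite pmulr_lge0 ?invr_gt0 ?exprn_gt0// subr_ge0 => rab.
by have := mulr_ge0 a0 (ltW b0); nra.
Qed.

(** Positive semidefinite Hermitian forms: one theory serves [ip], the form of [A] and the form of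
    the diagonal operator on the direct sum. *)
Record semi_inner (R : realType) (V : lmodType R[i]) (s : V -> V -> R[i]) :
    Prop := SemiInner {
  semi_innerPl : forall a x y z, s (a *: x + y) z = a * s x z + s y z;
  semi_innerC : forall x y, s y x = Num.conj (s x y);
  semi_inner_ge0 : forall x, 0 <= s x x
}.

Definition snorm (R : realType) (V : lmodType R[i]) (s : V -> V -> R[i])
  (x : V) : R := Num.sqrt (complex.Re (s x x)).

Section SemiInnerTheory.
Variables (R : realType) (V : lmodType R[i]) (s : V -> V -> R[i]).
Hypothesis sP : semi_inner s.
Implicit Types (x y z : V) (a : R[i]).

Local Notation rip x y := (complex.Re (s x y)).
Local Notation nrm x := (snorm s x).

Lemma siDl x y z : s (x + y) z = s x z + s y z.
Proof. by rewrite -[x]scale1r (semi_innerPl sP) mul1r scale1r. Qed.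

Lemma si0l z : s 0 z = 0.
Proof. by apply: (addrI (s 0 z)); rewrite -siDl !addr0. Qed.

Lemma siZl a x z : s (a *: x) z = a * s x z.
Proof. by rewrite -[a *: x]addr0 (semi_innerPl sP) si0l addr0. Qed.

Lemma siNl x z : s (- x) z = - s x z.
Proof. by rewrite -scaleN1r siZl mulN1r. Qed.

Lemma siBl x y z : s (x - y) z = s x z - s y z.
Proof. by rewrite siDl siNl. Qed.

Lemma siDr x y z : s z (x + y) = s z x + s z y.
Proof.
by rewrite (semi_innerC sP) siDl rmorphD/= -!(semi_innerC sP).
Qed.

Lemma siZr a x z : s z (a *: x) = Num.conj a * s z x.
Proof. by rewrite (semi_innerC sP) siZl rmorphM/= -(semi_innerC sP). Qed.

Lemma si0r z : s z 0 = 0.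
Proof. by rewrite (semi_innerC sP) si0l rmorph0. Qed.

Lemma siNr x z : s z (- x) = - s z x.
Proof. by rewrite (semi_innerC sP) siNl rmorphN/= -(semi_innerC sP). Qed.

Lemma si_sumr I (r : seq I) (F : I -> V) z :
  s z (\sum_(i <- r) F i) = \sum_(i <- r) s z (F i).
Proof.
by elim: r => [|i r IHr]; rewrite ?big_nil ?si0r// !big_cons siDr IHr.
Qed.

Lemma re_siC x y : (rip x y) = (rip y x).
Proof. by rewrite (semi_innerC sP); case: (s y x). Qed.

Lemma re_si_ge0 x : 0 <= (rip x x).
Proof. by have := semi_inner_ge0 sP x; rewrite lecE => /andP[]. Qed.

Lemma snorm_ge0 x : 0 <= (nrm x).
Proof. exact: sqrtr_ge0. Qed.

Lemma snorm_sqr x : (nrm x) ^+ 2 = (rip x x).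
Proof. by rewrite sqr_sqrtr// re_si_ge0. Qed.

Lemma si_self x : s x x = ((nrm x) ^+ 2)%:C%C.
Proof. by rewrite snorm_sqr RRe_real// ger0_real// (semi_inner_ge0 sP). Qed.

Lemma snorm0 : (nrm 0) = 0.
Proof. by rewrite /snorm si0l/= sqrtr0. Qed.

Lemma snormZ a x : (nrm (a *: x)) = cmod a * (nrm x).
Proof.
rewrite /snorm siZl siZr mulrA cmod_sqr si_self ReC/= snorm_sqr.
by rewrite sqrtrM ?sqr_ge0// sqrtr_sqr ger0_norm ?cmod_ge0.
Qed.

Lemma snormN x : (nrm (- x)) = (nrm x).
Proof. by rewrite /snorm siNl siNr opprK. Qed.

Lemma snormD_sqr x y :
  (nrm (x + y)) ^+ 2 = (nrm x) ^+ 2 + (nrm y) ^+ 2 + 2 * (rip x y).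
Proof.
rewrite !snorm_sqr siDl !siDr !raddfD/= (re_siC y x); ring.
Qed.

Lemma snormB_sqr x y :
  (nrm (x - y)) ^+ 2 = (nrm x) ^+ 2 + (nrm y) ^+ 2 - 2 * (rip x y).
Proof. by rewrite snormD_sqr snormN siNr raddfN/= mulrN. Qed.

(** Cauchy-Schwarz from |x - t y|^2 >= 0 for real t; vectors [y] of seminorm zero fall under the
    case [b = 0] of [discriminant_le]. *)
Lemma re_si_le x y : (rip x y) <= (nrm x) * (nrm y).
Proof.
have sq t : 0 <= (nrm x) ^+ 2 + t ^+ 2 * (nrm y) ^+ 2 - 2 * (t * (rip x y)).
  rewrite -[t ^+ 2]real_normK ?num_real// -cmodC -exprMn -snormZ.
  have := sqr_ge0 (nrm (x - t%:C%C *: y)).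
  by rewrite snormB_sqr siZr -[Num.conj _]/(conjc _) conjc_real ReC.
exact: discriminant_le (snorm_ge0 x) (snorm_ge0 y) sq.
Qed.

Lemma cmod_si_le x y : cmod (s x y) <= (nrm x) * (nrm y).
Proof.
have [c [c1 cE]] := phase_exists (s x y).
have := re_si_le (c *: x) y; rewrite siZl cE/= snormZ c1 mul1r => /le_trans.
exact.
Qed.

Lemma snormD x y : (nrm (x + y)) <= (nrm x) + (nrm y).
Proof.
rewrite -(@ler_pXn2r _ 2%N)// ?nnegrE ?addr_ge0 ?snorm_ge0// snormD_sqr.
by have := re_si_le x y; nra.
Qed.

End SemiInnerTheory.

(** * Power inequality and Kittaneh's bound *)

Lemma cmod1 (R : realType) : cmod (1 : R[i]) = 1.
Proof. by rewrite /cmod normr1. Qed.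

Lemma cmodX (R : realType) (z : R[i]) n : cmod (z ^+ n) = cmod z ^+ n.
Proof. by elim: n => [|n IHn]; rewrite ?cmod1// !exprS cmodM IHn. Qed.

Lemma cmod_unity_root (R : realType) (z : R[i]) n :
  (0 < n)%N -> z ^+ n = 1 -> cmod z = 1.
Proof.
move=> n_gt0 zn1; apply/eqP; rewrite -(@pexpr_eq1 _ _ n)// ?cmod_ge0//.
by rewrite -cmodX zn1 cmod1.
Qed.

Section NumericalRange.
Variables (R : realType) (V : lmodType R[i]) (s : V -> V -> R[i]).
Hypothesis sP : semi_inner s.

Local Notation rip x y := (complex.Re (s x y)).
Local Notation nrm x := (snorm s x).

Section PowerInequality.
Variable T : {linear V -> V}.

(* With [x_j = \sum_(m < n) (z^j T)^m x] for a primitive root [z],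
   [x - T^n x = x_j - z^j T x_j], and the [x_j] average to [x]. *)
Lemma re_iter_le n x : (0 < n)%N ->
    (forall y, cmod (s (T y) y) <= nrm y ^+ 2) ->
  rip (iter n T x) x <= nrm x ^+ 2.
Proof.
move=> n_gt0 wT; have [z zP] := prim_root_exists R[i] n_gt0.
have zn : z ^+ n = 1 := prim_expr_order zP.
pose xj (j : nat) := \sum_(m < n) (z ^+ j) ^+ m *: iter m T x.
have xjE j : xj j - z ^+ j *: T (xj j) = x - iter n T x.
  rewrite /xj linear_sum scaler_sumr -sumrB -opprB.
  transitivity (- \sum_(0 <= m < n) ((z ^+ j) ^+ m.+1 *: iter m.+1 T x -
                                   (z ^+ j) ^+ m *: iter m T x)).
    rewrite big_mkord -sumrN; apply: eq_bigr => m _.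
    by rewrite [T _]linearZ_LR/= scalerA -exprS opprB.
  rewrite (telescope_sumr (fun m => (z ^+ j) ^+ m *: iter m T x))//.
  by rewrite -exprM mulnC exprM zn expr1n expr0 !scale1r.
(* After exchanging the sums, m = 0 contributes [n%:R *: x]; any other m contributes 0, as z^m is a
   root of unity different from 1. *)
have sum_xj : \sum_(j < n) xj j = n%:R *: x.
  rewrite exchange_big/=; case: n n_gt0 zP zn {xj xjE} => // n _ zP zn.
  rewrite big_ord_recl/= [X in _ + X]big1 ?addr0 => [|m _].
    rewrite (eq_bigr (fun=> x)) => [|j _]; last by rewrite expr0 scale1r.
    by rewrite sumr_const card_ord scaler_nat.
  rewrite -scaler_suml (eq_bigr (fun j : 'I_n.+1 => (z ^+ (bump 0 m)) ^+ j)).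
    rewrite sum_expr_root_unity ?scale0r//.
      by rewrite -exprM mulnC exprM zn expr1n.
    by rewrite -(prim_order_dvd zP) gtnNdvd//= /bump/= add1n ltnS.
  by move=> j _; rewrite -!exprM mulnC.
(* Each term is |x_j|^2 - Re (z^j <T x_j, x_j>), and |z^j| = 1; the whole sum is n Re <x - T^n x,
   x>. *)
have : 0 <= \sum_(j < n) rip (x - iter n T x) (xj j).
  apply: sumr_ge0 => j _; rewrite -(xjE j) (siBl sP) raddfB/= -(snorm_sqr sP).
  rewrite subr_ge0 (le_trans _ (wT _))// (siZl sP).
  apply: le_trans (Re_le_cmod _) _.
  by rewrite cmodM cmodX (cmod_unity_root n_gt0 zn) expr1n mul1r.
rewrite -raddf_sum/= -(si_sumr sP) sum_xj (siZr sP) rmorph_nat.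
rewrite -(rmorph_nat (real_complex R)) ReC pmulr_rge0 ?ltr0n//.
by rewrite (siBl sP) raddfB/= -(snorm_sqr sP) subr_ge0.
Qed.

End PowerInequality.

Lemma iter_scale (T : {linear V -> V}) a n x :
  iter n (a \*: T) x = a ^+ n *: iter n T x.
Proof.
elim: n => [|n IHn]; first by rewrite scale1r.
by rewrite !iterS IHn/= linearZ scalerA exprS.
Qed.

(** Apply [re_iter_le] to t d T, where t w <= 1 and d is a root of the phase that makes <T^n x, x>
    real and nonnegative. For w > 0 take t = 1/w; for w = 0 let t grow. *)
Lemma power_inequality (T : {linear V -> V}) (w : R) n x : 0 <= w ->
    (forall y, cmod (s (T y) y) <= w * nrm y ^+ 2) ->
  cmod (s (iter n T x) x) <= w ^+ n * nrm x ^+ 2.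
Proof.
move=> w0 wT; case: n => [|n].
  by rewrite expr0 mul1r (si_self sP) cmodC ger0_norm ?sqr_ge0.
have bound (t : R) : 0 <= t -> t * w <= 1 ->
    t ^+ n.+1 * cmod (s (iter n.+1 T x) x) <= nrm x ^+ 2.
  move=> t0 tw; have [c [c1 cE]] := phase_exists (s (iter n.+1 T x) x).
  have [d dE] : exists d : R[i], d ^+ n.+1 = c.
    by exists (n.+1.-root c); rewrite rootCK.
  have d1 : cmod d = 1.
    by apply/eqP; rewrite -(@pexpr_eq1 _ _ n.+1) ?cmod_ge0// -cmodX dE c1.
  have := @re_iter_le ((t%:C%C * d) \*: T) n.+1 x isT.
  rewrite iter_scale (siZl sP) exprMn dE -mulrA cE -rmorphXn ReC/=; apply => y.
  rewrite (siZl sP) !cmodM cmodC ger0_norm// d1 mulr1.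
  apply: le_trans (ler_wpM2l t0 (wT y)) _.
  by rewrite mulrA ler_piMl ?sqr_ge0.
have [w00|w00] := eqVneq w 0; last first.
  have w_gt0 : 0 < w by rewrite lt_def w00.
  have := bound w^-1; rewrite invr_ge0 w0 mulVf// lexx exprVn => /(_ isT isT).
  by rewrite mulrC ler_pdivrMr ?exprn_gt0// mulrC.
rewrite w00 expr0n/= mul0r leNgt; apply/negP => k_gt0.
set k := cmod _ in bound k_gt0.
(* The summand 1 gives t <= t^(n+1), the other one gives t k > |x|^2. *)
pose t := (nrm x ^+ 2 + 1) / k + 1.
have t1 : 1 <= t by rewrite lerDr divr_ge0 ?ltW// ltr_wpDl ?sqr_ge0.
have := bound t; rewrite w00 mulr0 ler01 (le_trans ler01 t1) => /(_ isT isT).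
apply/negP; rewrite -ltNge; apply: (@lt_le_trans _ _ (t * k)).
  by rewrite mulrDl divfK ?gt_eqF// mul1r -addrA ltrDl addr_gt0.
by rewrite ler_pM2r// ler_eXnr.
Qed.

(* With [H = c T + c^* T'], [2 Re (c <T x, x>) = <H x, x>] and
   [|H x|^2 <= f + 2 |<T^2 x, x>|] where [f = |T x|^2 + |T' x|^2]; applying
   Cauchy-Schwarz to [f = <T (T' x) + T' (T x), x>] bounds [f] by
   [(a^2 + b^2) |x|^2]. *)
Lemma num_range_le (T T' : V -> V) (a b : R) x :
    (forall x y, s (T x) y = s x (T' y)) -> 0 <= a -> 0 <= b ->
    (forall x, nrm (T x) <= a * nrm x) ->
    (forall x, nrm (T (T x)) <= b ^+ 2 * nrm x) ->
  cmod (s (T x) x) <= (a + b) / 2 * nrm x ^+ 2.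
Proof.
move=> adj a0 b0 Ta TTb.
(* If a < b, Cauchy-Schwarz alone suffices; otherwise b <= a yields b^2 <= a b below. *)
have [ab|ba] := ltP a b.
  apply: le_trans (cmod_si_le sP _ _) _; apply: le_trans (ler_wpM2r _ (Ta x)) _.
    exact: snorm_ge0.
  by rewrite -[leLHS]mulrA -expr2 ler_wpM2r ?sqr_ge0//; lra.
have adj' y z : s (T' y) z = s y (T z).
  by rewrite (semi_innerC sP) -adj -(semi_innerC sP).
have T'a y : nrm (T' y) <= a * nrm y.
  have := re_si_le sP (T (T' y)) y; rewrite adj -(snorm_sqr sP).
  have := Ta (T' y); have := snorm_ge0 s (T' y); have := snorm_ge0 s y.
  have [->|t0] := eqVneq (nrm (T' y)) 0; first by move=> *; rewrite mulr_ge0.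
  move=> y0 t_ge0 t1 t2; have t_gt0 : 0 < nrm (T' y) by rewrite lt_def t0.
  by rewrite -(ler_pM2l t_gt0); nra.
pose u := T' x; pose v := T x; pose f := nrm u ^+ 2 + nrm v ^+ 2.
have fE : f = rip (T u + T' v) x.
  by rewrite (siDl sP) raddfD/= adj adj' /f !(snorm_sqr sP).
have f0 : 0 <= f by rewrite addr_ge0 ?sqr_ge0.
have x0 := snorm_ge0 s x.
(* The cross term is <T u, T' v> = <T^2 u, v>, at most b^2 |u| |v| <= b^2 f / 2. *)
have uv2 : nrm (T u + T' v) ^+ 2 <= (a ^+ 2 + b ^+ 2) * f.
  rewrite (snormD_sqr sP) -adj.
  have := re_si_le sP (T (T u)) v.
  have := Ta u; have := T'a v; have := TTb u; rewrite /f.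
  have := snorm_ge0 s (T u); have := snorm_ge0 s (T' v).
  have := snorm_ge0 s (T (T u)).
  have := snorm_ge0 s u; have := snorm_ge0 s v.
  move: (nrm v) (nrm u) (nrm (T (T u))) (nrm (T' v)) (nrm (T u))
    (rip (T (T u)) v).
  move=> V0 U0 TTU T'V TU r V00 U00 TTU0 T'V0 TU0 h1 h2 h3 h4.
  have i1 : TU ^+ 2 <= a ^+ 2 * U0 ^+ 2.
    by rewrite -exprMn ler_sqr ?nnegrE ?mulr_ge0.
  have i2 : T'V ^+ 2 <= a ^+ 2 * V0 ^+ 2.
    by rewrite -exprMn ler_sqr ?nnegrE ?mulr_ge0.
  have i3 : r <= b ^+ 2 * (U0 * V0).
    by apply: le_trans h4 _; rewrite mulrA ler_wpM2r.
  have i4 : 2 * (U0 * V0) <= U0 ^+ 2 + V0 ^+ 2 by have := sqr_ge0 (U0 - V0); nra.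
  have : b ^+ 2 * (2 * (U0 * V0)) <= b ^+ 2 * (U0 ^+ 2 + V0 ^+ 2).
    by rewrite ler_wpM2l ?sqr_ge0.
  by nra.
have f_le : f <= (a ^+ 2 + b ^+ 2) * nrm x ^+ 2.
  have [->|fn0] := eqVneq f 0; first by rewrite mulr_ge0 ?addr_ge0 ?sqr_ge0.
  have f_gt0 : 0 < f by rewrite lt_def fn0.
  rewrite -(ler_pM2l f_gt0) -expr2.
  apply: (@le_trans _ _ ((nrm (T u + T' v) * nrm x) ^+ 2)).
    by rewrite ler_sqr ?nnegrE ?mulr_ge0 ?snorm_ge0// fE re_si_le.
  by rewrite exprMn [leRHS]mulrA ler_wpM2r ?sqr_ge0// mulrC.
have [c [c1 cE]] := phase_exists (s (T x) x).
pose H := c *: v + Num.conj c *: u.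
have HE : rip H x = 2 * cmod (s (T x) x).
  rewrite /H (siDl sP) !(siZl sP) /v cE /u adj'.
  rewrite (semi_innerC sP (T x)) -rmorphM/= cE.
  by rewrite -[Num.conj _]/(conjc _) conjc_real/=; ring.
(* |H|^2 <= f + 2 b^2 |x|^2 <= (a^2 + b^2 + 2 a b) |x|^2, a perfect square. *)
have H2 : nrm H ^+ 2 <= (a + b) ^+ 2 * nrm x ^+ 2.
  rewrite (snormD_sqr sP) !(snormZ sP) cmod_conj c1 !mul1r.
  have -> : rip (c *: v) (Num.conj c *: u) = rip (c ^+ 2 *: T v) x.
    by rewrite !(siZl sP) (siZr sP) -adj conjCK mulrA.
  have h : rip (c ^+ 2 *: T v) x <= b ^+ 2 * nrm x ^+ 2.
    apply: le_trans (re_si_le sP _ _) _.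
    rewrite (snormZ sP) cmodX c1 expr1n mul1r [nrm x ^+ 2]expr2 mulrA.
    by rewrite ler_wpM2r//; exact: TTb.
  have h' : b ^+ 2 * nrm x ^+ 2 <= a * b * nrm x ^+ 2.
    by rewrite ler_wpM2r ?sqr_ge0// expr2 ler_wpM2r.
  by move: f_le; rewrite /f; nra.
have Hx : nrm H <= (a + b) * nrm x.
  by rewrite -ler_sqr ?nnegrE ?mulr_ge0 ?addr_ge0 ?snorm_ge0// exprMn.
have := le_trans (re_si_le sP H x) (ler_wpM2r x0 Hx).
by rewrite HE; nra.
Qed.

End NumericalRange.

(** * Uniform boundedness *)

Lemma expr_bernoulli (R : realDomainType) (h : R) n :
  0 <= h -> 1 + n%:R * h <= (1 + h) ^+ n.
Proof.
move=> h0; elim: n => [|n IHn]; first by rewrite mul0r addr0 expr0.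
have h' : 0 <= n%:R * h * h by rewrite !mulr_ge0.
by rewrite exprS; move: IHn; rewrite -natr1; nra.
Qed.

Lemma expr_unbounded (R : realType) (u K : R) :
  1 < u -> exists n, forall m, (n <= m)%N -> K < u ^+ m.
Proof.
move=> u1; have u1' : 0 < u - 1 by rewrite subr_gt0.
exists (Num.bound (`|K| / (u - 1))) => m le_m.
have : `|K| / (u - 1) < m%:R.
  have h : 0 <= `|K| / (u - 1) by rewrite divr_ge0 // ltW.
  by apply: lt_le_trans (archi_boundP h) _; rewrite ler_nat.
rewrite ltr_pdivrMr// => Km; have := expr_bernoulli m (ltW u1').
rewrite subrKC; apply: lt_le_trans; apply: le_lt_trans (ler_norm K) _.
by rewrite (lt_trans Km)// ltrDr.
Qed.

(** * Moment growth of maps symmetric for a semi-inner product *)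

Section SymmetrizableBound.
Variables (R : realType) (V : lmodType R[i]) (s : V -> V -> R[i]).
Hypothesis sP : semi_inner s.
Variable S : V -> V.
Hypothesis S_sym : forall x y, s (S x) y = s x (S y).

Lemma sym_iter n x y : s (iter n S x) y = s x (iter n S y).
Proof. by elim: n x => // n IHn x; rewrite iterSr IHn S_sym. Qed.

(* The moments [<S^m x, x>] are log-convex along [m = 2^k] by Cauchy-Schwarz,
   so their geometric growth rate controls the first one. *)
Lemma sym_moment_bound (K M : R) x : 0 < M ->
    (forall m, complex.Re (s (iter m S x) x) <= K * M ^+ m) ->
    0 <= complex.Re (s (S x) x) ->
  complex.Re (s (S x) x) <= M * snorm s x ^+ 2.
Proof.
move=> M0 mom a1; have x0 := snorm_ge0 s x.
have [x00|x00] := eqVneq (snorm s x) 0.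
  by have := re_si_le sP (S x) x; rewrite x00 expr0n !mulr0.
have q0 : 0 < snorm s x ^+ 2 by rewrite exprn_gt0// lt_def x00.
pose u := complex.Re (s (S x) x) / snorm s x ^+ 2.
have u0 : 0 <= u by rewrite divr_ge0 ?sqr_ge0.
(* Doubling step: <S^(2m) x, x> = |S^m x|^2 >= <S^m x, x>^2 / |x|^2. *)
have uk k : u ^+ (2 ^ k) <= complex.Re (s (iter (2 ^ k) S x) x) / snorm s x ^+ 2.
  elim: k => [//|k IHk]; rewrite expnS mulnC exprM.
  set m := (2 ^ k)%N in IHk *.
  have um : 0 <= u ^+ m by rewrite exprn_ge0.
  apply: le_trans (_ : (complex.Re (s (iter m S x) x) / snorm s x ^+ 2) ^+ 2 <= _).
    by rewrite ler_sqr ?nnegrE// (le_trans um).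
  rewrite muln2 -addnn iterD (sym_iter m (iter m S x)) -(snorm_sqr sP).
  have : complex.Re (s (iter m S x) x) ^+ 2 <=
      snorm s (iter m S x) ^+ 2 * snorm s x ^+ 2.
    rewrite -exprMn ler_sqr ?nnegrE ?mulr_ge0 ?snorm_ge0//.
      exact: re_si_le.
    by move: (le_trans um IHk); rewrite pmulr_lge0 ?invr_gt0.
  move: (snorm s x ^+ 2) q0 => q q0 le.
  by rewrite expr_div_n ler_pdivrMr ?exprn_gt0// expr2 mulrA divfK ?gt_eqF.
(* If u > M, the powers (u / M)^(2^k) are unbounded, yet [uk] and [mom] keep them below K /
   |x|^2. *)
rewrite -ler_pdivrMr// -/u leNgt; apply/negP => Mu.
have [|n nP] := @expr_unbounded _ (u / M) (K / snorm s x ^+ 2).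
  by rewrite ltr_pdivlMr// mul1r.
have := nP (2 ^ n)%N; rewrite (ltnW (@ltn_expl 2 n isT)) => /(_ isT).
apply/negP; rewrite -leNgt expr_div_n ler_pdivrMr ?exprn_gt0//.
apply: le_trans (uk n) _; rewrite [leRHS]mulrAC ler_pM2r ?invr_gt0//.
Qed.

End SymmetrizableBound.

(** * Completeness and weakly bounded sets in a Hilbert space *)

Section HilbertSpace.
Variables (R : realType) (H : completeNormedModType R[i]).
Variables (ip : inner_product H).
Hypothesis ip_norm : forall x : H, ip x x = `|x| ^+ 2.

Lemma semi_inner_ip : semi_inner ip.
Proof.
split=> [a x y z|x y|x]; first by rewrite linearPl.
- by rewrite (hermC ip) expr0 mul1r.
- by rewrite dnorm_ge0.
Qed.

Local Notation nrm x := (snorm ip x).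

Lemma normE (x : H) : `|x| = (nrm x)%:C%C.
Proof.
apply/eqP; rewrite -(@eqrXn2 _ 2%N) ?ler0c ?snorm_ge0//.
by rewrite -ip_norm (si_self semi_inner_ip) rmorphXn.
Qed.

Lemma bounded_op_le (f : {linear H -> H}) : bounded_op f ->
  exists2 c : R, 0 < c & forall x, nrm (f x) <= c * nrm x.
Proof.
move=> /linear_boundedP /pinfty_ex_gt0[r r0 fr].
have rE : r = (complex.Re r)%:C%C by rewrite RRe_real// gtr0_real.
exists (complex.Re r) => [|x]; first by rewrite -ltcR -rE.
by have := fr x; rewrite !normE rE -rmorphM lecR.
Qed.

Lemma geometric_cauchy_limit (x : nat -> H) (c : R) :
    (forall n k, nrm (x (n + k)%N - x n) <= c / 3 ^+ n) ->
  exists l, forall n, nrm (l - x n) <= c / 3 ^+ n.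
Proof.
move=> xc.
have small (e : R[i]) : 0 < e -> exists n, (c / 3 ^+ n)%:C%C < e.
  move=> e0; have eE : e = (complex.Re e)%:C%C by rewrite RRe_real// gtr0_real.
  have e0' : 0 < complex.Re e by rewrite -ltcR -eE.
  have [|n /(_ n (leqnn n)) nP] := @expr_unbounded R 3 (c / complex.Re e).
    by rewrite ltr1n.
  exists n; rewrite eE ltcR ltr_pdivrMr ?exprn_gt0// mulrC.
  by rewrite -ltr_pdivrMr.
have /cvg_ex[l xl] : cvg (x @ \oo).
  apply/cauchy_cvgP/cauchy_exP => e e0; have [n ne] := small _ e0.
  exists (x n); exists n => // m /= nm.
  rewrite -ball_normE/= distrC -[m](subnKC nm) normE.
  by apply: le_lt_trans ne; rewrite lecR.
exists l => n; apply/ler_addgt0Pr => e e0.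
have /cvgrPdist_le/(_ e%:C%C) := xl; rewrite ltcR => /(_ e0)[m _ /(_ (n + m)%N)].
rewrite /= leq_addl normE lecR => /(_ isT) le.
rewrite -(subrK (x (n + m)%N) l) -addrA addrC.
by apply: le_trans (snormD semi_inner_ip _ _) _; rewrite lerD.
Qed.

(* Gliding hump: the sign of the n-th step of size [3^-n] in the direction of
   [b n], [|b n| > 4^n], is chosen so that the limit pairs with [b n] to at
   least [3^-n |b n| / 2].  ([Banach_Steinhauss] only covers real scalars.) *)
Lemma weakly_bounded (B : set H) :
    (forall y, exists M, forall b, B b -> cmod (ip y b) <= M) ->
  exists M, forall b, B b -> nrm b <= M.
Proof.
move=> wB; have sP := semi_inner_ip; apply: contrapT => nB.
have /choice[b bP] n : exists b, B b /\ 4 ^+ n < nrm b.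
  apply: contrapT => nb; apply: nB; exists (4 ^+ n) => b Bb.
  by rewrite leNgt; apply/negP => bn; apply: nb; exists b.
have b0 n : 0 < nrm (b n) by apply: le_lt_trans (bP n).2; rewrite exprn_ge0.
pose v n := (3 ^- n / nrm (b n))%:C%C *: b n.
have v_norm n : nrm (v n) = 3 ^- n.
  rewrite (snormZ sP) cmodC ger0_norm ?divfK ?gt_eqF//.
  by rewrite divr_ge0 ?invr_ge0 ?exprn_ge0// ltW.
have /choice[step stepP] (nx : nat * H) : exists y,
    nrm (y - nx.2) = 3 ^- nx.1 /\
    3 ^- nx.1 * nrm (b nx.1) <= cmod (ip y (b nx.1)).
  case: nx => n x /=.
  have vb : cmod (ip (v n) (b n)) = 3 ^- n * nrm (b n).
    rewrite /v (siZl sP) (si_self sP) -rmorphM cmodC ger0_norm.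
      by rewrite expr2 mulrA divfK ?gt_eqF.
    by rewrite mulr_ge0 ?sqr_ge0// divr_ge0 ?invr_ge0 ?exprn_ge0// ltW.
  (* The pairings of [x + v n] and [x - v n] with [b n] differ by [2 * ip (v n) (b n)], so one of
     them is large enough. *)
  have [le|lt] := leP (3 ^- n * nrm (b n)) (cmod (ip (x + v n) (b n))).
    by exists (x + v n); rewrite addrAC subrr add0r.
  exists (x - v n); rewrite addrAC subrr add0r (snormN sP); split=> //.
  have : cmod (2 * ip (v n) (b n)) <=
      cmod (ip (x + v n) (b n)) + cmod (ip (x - v n) (b n)).
    rewrite -lecR rmorphD/= -!cmodE (_ : 2 * _ =
      ip (x + v n) (b n) - ip (x - v n) (b n)) ?ler_normB//.
    by rewrite (siBl sP) (siDl sP); ring.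
  have -> : (2 : R[i]) = (2 : R)%:C%C by rewrite rmorph_nat.
  by rewrite cmodM cmodC ger0_norm// vb; lra.
pose x := fix x n := if n is m.+1 then step (m, x m) else 0.
(* 3/2 is the sum of the powers of 1/3; the induction uses the exact partial sums. *)
have xc n k : nrm (x (n + k)%N - x n) <= (3 / 2) / 3 ^+ n.
  suff : nrm (x (n + k)%N - x n) <= 3 / 2 * (3 ^- n - 3 ^- (n + k)).
    move/le_trans; apply; rewrite ler_wpM2l// gerDl oppr_le0.
    by rewrite invr_ge0 exprn_ge0.
  elim: k => [|k IHk]; first by rewrite addn0 !subrr (snorm0 sP) mulr0.
  rewrite -(subrK (x (n + k)%N) (x _)) -addrA.
  apply: le_trans (snormD sP _ _) _; rewrite addnS /=.
  rewrite (stepP (_, _)).1/=; apply: le_trans (lerD (lexx _) IHk) _.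
  by rewrite exprS invfM; lra.
have [l lx] := geometric_cauchy_limit xc.
have [M Ml] := wB l.
(* The limit pairs with [b n] to at least 3^-n |b n| / 2 > (4/3)^n / 2, which must not exceed M. *)
have [|n /(_ n (leqnn n))] := @expr_unbounded R (4 / 3) (2 * M); first by lra.
apply/negP; rewrite -leNgt expr_div_n.
have := Ml _ (bP n).1; have := (stepP (n, x n)).2; rewrite /= -/(x n.+1).
(* All later steps move the point by at most (3/2) / 3^(n+1), which costs half of the gain at step
   n. *)
have h : cmod (ip (x n.+1) (b n)) <= cmod (ip l (b n)) + nrm (b n) / (2 * 3 ^+ n).
  have : cmod (ip (l - x n.+1) (b n)) <= nrm (b n) / (2 * 3 ^+ n).
    apply: le_trans (cmod_si_le sP _ _) _.
    rewrite mulrC ler_wpM2l ?(ltW (b0 n))//.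
    apply: le_trans (lx _) _; rewrite exprS !invfM mulrA.
    by rewrite ler_wpM2r ?invr_ge0 ?exprn_ge0//; lra.
  rewrite -[ip (x _) _](subKr (ip l (b n))) -(siBl sP) => h.
  rewrite -lecR rmorphD/= -!cmodE (le_trans (ler_normB _ _))//.
  by rewrite !cmodE -!rmorphD lecR lerD2l.
move=> h1 h2; have := (bP n).2 => h3.
have p3 : 0 < 3 ^- n :> R by rewrite invr_gt0 exprn_gt0.
have : 4 ^+ n * 3 ^- n <= nrm (b n) * 3 ^- n by rewrite ler_pM2r// ltW.
by move: h; rewrite invfM; nra.
Qed.

End HilbertSpace.

(** * Operators on a semi-Hilbert space *)

(** Sets without a supremum are covered too, as [sup] is then 0. *)
Lemma sup_ge0 (R : realType) (E : set R) :
  (forall x, E x -> 0 <= x) -> 0 <= sup E.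
Proof.
move=> E0; have [[[x Ex] ubE]|/sup_out->//] := pselect (has_sup E).
exact: le_trans (E0 x Ex) (ub_le_sup ubE Ex).
Qed.

Lemma semi_inner_semi_ip (R : realType) (V : lmodType R[i])
    (ip : inner_product V) (A : {linear V -> V}) :
  positive_op ip A -> semi_inner (semi_ip ip A).
Proof.
move=> [A_sym A_ge0]; split=> [a x y z|x y|//]; rewrite /semi_ip.
  by rewrite linearP linearPl.
by rewrite A_sym (hermC ip) expr0 mul1r.
Qed.

Section SemiHilbertOperators.
Variables (R : realType) (H : completeNormedModType R[i]).
Variables (ip : inner_product H).
Hypothesis ip_norm : forall x : H, ip x x = `|x| ^+ 2.
Variable A : {linear H -> H}.
Hypotheses (A_bounded : bounded_op A) (A_positive : positive_op ip A).

Local Notation sA := (semi_ip ip A).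
Local Notation nrm x := (snorm ip x).
Local Notation nrmA x := (snorm sA x).

Let ipP : semi_inner ip := semi_inner_ip ip.
Let sP : semi_inner sA := semi_inner_semi_ip A_positive.

Lemma adjoint_le (T Tstar : H -> H) (c : R) x : is_adjoint ip T Tstar ->
  (forall x, nrm (T x) <= c * nrm x) -> nrm (Tstar x) <= c * nrm x.
Proof.
move=> adj Tc; have [->|t0] := eqVneq (nrm (Tstar x)) 0.
  have [->|x0] := eqVneq (nrm x) 0; first by rewrite mulr0.
  apply: le_trans (Tc x); exact: snorm_ge0.
have t_gt0 : 0 < nrm (Tstar x) by rewrite lt_def t0 snorm_ge0.
rewrite -(ler_pM2l t_gt0) -expr2 (snorm_sqr ipP) -adj.
apply: le_trans (re_si_le ipP _ _) _.
by rewrite mulrCA mulrA ler_wpM2r ?snorm_ge0.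
Qed.

(** The range inclusion lets [X] be chosen pointwise, as a bare function, with
    [A (X y) = Tstar (A y)]; the bound is then that of [Tstar]. *)
Lemma LA_adjoint (T : {linear H -> H}) : LA ip A T ->
  exists X : H -> H, (forall x y, sA (T x) y = sA x (X y)) /\
    exists2 c : R, 0 < c & forall x, nrm (A (X x)) <= c * nrm (A x).
Proof.
move=> [/(bounded_op_le ip_norm)[c c0 Tc] [Tstar adj ran]].
have /choice[X XP] y : exists z, A z = Tstar (A y).
  by have [|z _ zE] := ran (Tstar (A y)); [exists y|exists z].
have [A_sym _] := A_positive.
exists X; split => [x y|].
  by rewrite /semi_ip A_sym adj -XP A_sym.
by exists c => // x; rewrite XP; exact: adjoint_le adj Tc.
Qed.

(* The vectors [A (T x)] with [|A x| <= 1] are weakly bounded, since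
   [<y, A T x> = <X y, A x>]. *)
Lemma LA_range_bounded (T : {linear H -> H}) : LA ip A T ->
  exists2 C : R, 0 < C & forall x, nrm (A (T x)) <= C * nrm (A x).
Proof.
move=> /LA_adjoint[X [adj _]]; have [A_sym _] := A_positive.
pose B := [set A (T x) | x in [set x | nrm (A x) <= 1]].
have [y|C BC] := weakly_bounded ip_norm (B := B).
  exists (nrm (X y)) => _ [x /= x1 <-].
  rewrite -A_sym -/(sA y (T x)) (semi_innerC sP) adj -(semi_innerC sP).
  rewrite /semi_ip A_sym.
  apply: le_trans (cmod_si_le ipP _ _) _.
  by rewrite ler_piMr ?snorm_ge0.
have BC' (t : R) x : 0 <= t -> t * nrm (A x) <= 1 -> t * nrm (A (T x)) <= C.
  move=> t0 t1; have := BC (A (T (t%:C%C *: x))).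
  rewrite !linearZ/= !(snormZ ipP) cmodC ger0_norm//; apply.
  exists (t%:C%C *: x); last by rewrite !linearZ.
  by rewrite /= !linearZ/= !(snormZ ipP) cmodC ger0_norm.
have C0 : 0 <= C.
  by have := BC' 0 0 (lexx _); rewrite !mul0r; apply.
exists (C + 1) => [|x]; first by rewrite ltr_wpDl.
have x0 := snorm_ge0 ip (A x).
have [x00|x00] := eqVneq (nrm (A x)) 0.
  (* When A x = 0 every scaling is admissible, and this one would give C + 1 <= C. *)
  rewrite x00 mulr0 leNgt; apply/negP => Tx0.
  have := BC' ((C + 1) / nrm (A (T x))) x.
  rewrite x00 mulr0 ler01 divr_ge0 ?(ltW Tx0) ?ltr_wpDl ?addr_ge0//.
  move=> /(_ isT isT).
  by rewrite divfK ?gt_eqF//; lra.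
have := BC' (nrm (A x))^-1 x; rewrite invr_ge0 x0 mulVf// lexx => /(_ isT isT).
rewrite mulrC ler_pdivrMr ?lt_def ?x00// => /le_trans; apply.
by rewrite ler_wpM2r// lerDl.
Qed.

(** S = X T is symmetric for the A-form with <S x, x>_A = |T x|_A^2. Its moments are at most |A S^m
    x| |x|, of growth rate c C, whence the constant sqrt(c C). *)
Lemma LA_bounded (T : {linear H -> H}) : LA ip A T ->
  exists2 M : R, 0 <= M & forall x, nrmA (T x) <= M * nrmA x.
Proof.
move=> hT; have [X [adj [c c0 Xc]]] := LA_adjoint hT.
have [C C0 TC] := LA_range_bounded hT.
have adj' x y : sA (X x) y = sA x (T y).
  by rewrite (semi_innerC sP) -adj -(semi_innerC sP).
pose S x := X (T x).
have S_sym x y : sA (S x) y = sA x (S y) by rewrite /S adj' adj.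
have Sm m x : nrm (A (iter m S x)) <= (c * C) ^+ m * nrm (A x).
  elim: m => [|m IHm]; first by rewrite mul1r.
  rewrite iterS exprS /S; apply: le_trans (Xc _) _.
  rewrite -mulrA -mulrA ler_pM2l//; apply: le_trans (TC _) _.
  by rewrite ler_pM2l.
exists (Num.sqrt (c * C)) => [|x]; first exact: sqrtr_ge0.
have cC0 : 0 < c * C by rewrite mulr_gt0.
have TS : complex.Re (sA (S x) x) = nrmA (T x) ^+ 2.
  by rewrite adj' (snorm_sqr sP).
rewrite -ler_sqr ?nnegrE ?mulr_ge0 ?sqrtr_ge0 ?snorm_ge0//.
rewrite exprMn (sqr_sqrtr (ltW cC0)) -TS.
apply: (sym_moment_bound sP S_sym (K := nrm (A x) * nrm x)) => // [m|].
  apply: le_trans (re_si_le ipP _ _) _.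
  by rewrite mulrAC ler_wpM2r ?snorm_ge0// mulrC.
by rewrite TS sqr_ge0.
Qed.

(* Richardson iteration [y - A y / c]: each step lowers [|y|^2] by at least
   [|y|_A^2 / c], and the residual always differs from [x] by a range element. *)
Lemma range_dense x (e : R) : 0 < e -> exists z, nrmA (x - A z) < e.
Proof.
move=> e0; have [c c0 Ac] := bounded_op_le ip_norm A_bounded.
have [A_sym _] := A_positive.
(* Combine |A y|^2 = <y, A y>_A <= |y|_A |A y|_A with |A y|_A^2 <= c |A y|^2. *)
have Asq y : nrm (A y) ^+ 2 <= c * nrmA y ^+ 2.
  have h1 : nrm (A y) ^+ 2 <= nrmA y * nrmA (A y).
    by rewrite (snorm_sqr ipP); exact: (re_si_le sP y (A y)).
  have h2 : nrmA (A y) ^+ 2 <= c * nrm (A y) ^+ 2.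
    rewrite (snorm_sqr sP) expr2 mulrA.
    apply: le_trans (re_si_le ipP _ _) _.
    by rewrite ler_wpM2r ?snorm_ge0.
  have [->|n0] := eqVneq (nrm (A y)) 0.
    by rewrite expr0n/= mulr_ge0 ?sqr_ge0// ltW.
  have n_gt0 : 0 < nrm (A y) ^+ 2 by rewrite exprn_gt0// lt_def n0 snorm_ge0.
  rewrite -(ler_pM2l n_gt0) -expr2.
  apply: (@le_trans _ _ ((nrmA y * nrmA (A y)) ^+ 2)).
    by rewrite ler_sqr ?nnegrE ?mulr_ge0 ?sqr_ge0 ?snorm_ge0.
  by have := ler_wpM2l (sqr_ge0 (nrmA y)) h2; rewrite exprMn; lra.
pose y k := iter k (fun y => y - (c^-1)%:C%C *: A y) x.
have yS k : y k.+1 = y k - (c^-1)%:C%C *: A (y k) by [].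
have yE k : exists z, y k = x - A z.
  elim: k => [|k [z zE]]; first by exists 0; rewrite linear0 subr0.
  exists (z + (c^-1)%:C%C *: y k).
  by rewrite yS {1}zE [A (z + _)]linearD [A (_ *: _)]linearZ_LR opprD addrA.
have descent k : nrm (y k.+1) ^+ 2 <= nrm (y k) ^+ 2 - c^-1 * nrmA (y k) ^+ 2.
  rewrite yS (snormB_sqr ipP) (snormZ ipP) (siZr ipP) cmodC.
  rewrite -[Num.conj _]/(conjc _) conjc_real ReC -A_sym -(snorm_sqr sP).
  rewrite exprMn real_normK ?num_real//.
  have ci : 0 < c^-1 by rewrite invr_gt0.
  have : c^-1 ^+ 2 * nrm (A (y k)) ^+ 2 <= c^-1 * nrmA (y k) ^+ 2.
    by rewrite expr2 -mulrA ler_pM2l// mulrC ler_pdivrMr// mulrC.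
  by lra.
apply: contrapT => ne.
have far k : e ^+ 2 <= nrmA (y k) ^+ 2.
  rewrite ler_sqr ?nnegrE ?snorm_ge0 ?(ltW e0)// leNgt; apply/negP => lt.
  by have [z zE] := yE k; apply: ne; exists z; rewrite -zE.
(* If the residuals stay [e]-far in seminorm, |y_k|^2 decreases at a linear rate and ends up
   negative. *)
have sum k : nrm (y k) ^+ 2 <= nrm x ^+ 2 - k%:R * (c^-1 * e ^+ 2).
  elim: k => [|k IHk]; first by rewrite mul0r subr0.
  have : c^-1 * e ^+ 2 <= c^-1 * nrmA (y k) ^+ 2 by rewrite ler_pM2l ?invr_gt0.
  by have := descent k; rewrite -natr1; lra.
have d0 : 0 < c^-1 * e ^+ 2 by rewrite mulr_gt0 ?invr_gt0 ?exprn_gt0.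
have q0 : 0 <= nrm x ^+ 2 / (c^-1 * e ^+ 2) by rewrite divr_ge0 ?sqr_ge0 ?ltW.
have := archi_boundP q0; rewrite ltr_pdivrMr// ltNge => /negP; apply.
by rewrite -subr_ge0 (le_trans _ (sum _))// sqr_ge0.
Qed.

Lemma op_seminorm_has_ub (T : H -> H) (M : R) :
    (forall x, nrmA (T x) <= M * nrmA x) ->
  has_ubound [set semi_norm ip A (T x) / semi_norm ip A x
             | x in [set x | closure (range A) x /\ x != 0]].
Proof.
move=> TM; exists (Num.max M 0) => _ [x _ <-].
(* A zero denominator makes the quotient 0, hence the maximum with 0. *)
have [->|x0] := eqVneq (semi_norm ip A x) 0.
  by rewrite invr0 mulr0 le_max lexx orbT.
rewrite ler_pdivrMr.
  by rewrite (le_trans (TM x))// ler_wpM2r ?snorm_ge0// le_max lexx.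
by rewrite lt_def x0 sqrtr_ge0.
Qed.

Lemma op_seminorm_ge0 (T : H -> H) : 0 <= op_seminorm ip A T.
Proof.
by apply: sup_ge0 => _ [x _ <-]; rewrite divr_ge0 ?sqrtr_ge0.
Qed.

(** The crude constant [M] makes the supremum genuine and controls T on the small difference between
    x and a range vector. *)
Lemma op_seminormP (T : {linear H -> H}) (M : R) :
    (forall x, nrmA (T x) <= M * nrmA x) ->
  forall x, nrmA (T x) <= op_seminorm ip A T * nrmA x.
Proof.
move=> TM x; set N := op_seminorm _ _ _.
have N0 : 0 <= N := op_seminorm_ge0 T.
have M0 : forall y, nrmA y != 0 -> 0 <= M.
  move=> y y0; have := le_trans (snorm_ge0 sA (T y)) (TM y).
  by rewrite pmulr_lge0// lt_def y0 snorm_ge0.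
have onrange z : nrmA (T (A z)) <= N * nrmA (A z).
  have [z0|z0] := eqVneq (nrmA (A z)) 0.
    by have := TM (A z); rewrite z0 !mulr0.
  rewrite -ler_pdivrMr; last by rewrite lt_def z0 snorm_ge0.
  apply: ub_le_sup; first exact: op_seminorm_has_ub TM.
  exists (A z) => //; split; first by apply: subset_closure; exists z.
  by apply: contraNneq z0 => ->; rewrite (snorm0 sP).
apply/ler_addgt0Pr => e e0.
(* Replacing x by A z costs (N + |M|) |d|_A in total; adding 1 keeps the divisor positive. *)
have K0 : 0 < N + `|M| + 1 by rewrite ltr_wpDl// addr_ge0.
have [z xz] := @range_dense x (e / (N + `|M| + 1)) (divr_gt0 e0 K0).
set d := x - A z in xz.
have d0 : 0 <= nrmA d := snorm_ge0 _ _.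
have dE : (N + `|M| + 1) * nrmA d < e by rewrite mulrC -ltr_pdivlMr.
have Td : nrmA (T d) <= `|M| * nrmA d.
  by apply: le_trans (TM d) _; rewrite ler_wpM2r// ler_norm.
have Az : nrmA (A z) <= nrmA x + nrmA d.
  by rewrite -[A z](subKr x) -/d -(snormN sP d) snormD.
have : nrmA (T x) <= nrmA (T (A z)) + nrmA (T d).
  by rewrite -[x in leLHS](subrKC (A z)) linearD snormD.
have := onrange z.
have : N * nrmA (A z) <= N * (nrmA x + nrmA d) by rewrite ler_wpM2l.
by nra.
Qed.

End SemiHilbertOperators.

(** * The numerical radius as a constant in quadratic-form bounds *)

Section NumericalRadius.
Variables (R : realType) (V : lmodType R[i]) (ip : inner_product V).
Variable A : V -> V.
Hypothesis sP : semi_inner (semi_ip ip A).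
Local Notation sA := (semi_ip ip A).
Local Notation nrmA x := (snorm sA x).

Lemma num_radius_ge0 (T : V -> V) : 0 <= num_radius ip A T.
Proof. by apply: sup_ge0 => _ [x _ <-]; exact: cmod_ge0. Qed.

Lemma num_radius_le (T : V -> V) (c : R) : 0 <= c ->
  (forall x, cmod (sA (T x) x) <= c * nrmA x ^+ 2) -> num_radius ip A T <= c.
Proof.
move=> c0 Tc; rewrite /num_radius; set E := [set _ | _ in _].
(* Without vectors of seminorm 1 the supremum is 0, and [0 <= c] concludes. *)
have [->|E0] := eqVneq E set0; first by rewrite sup0.
apply: ge_sup => [|_ [x /= x1 <-]]; first exact/set0P.
by have := Tc x; rewrite [nrmA x]x1 expr1n mulr1.
Qed.

Lemma num_radiusP (T : {linear V -> V}) (c : R) x :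
    (forall x, cmod (sA (T x) x) <= c * nrmA x ^+ 2) ->
  cmod (sA (T x) x) <= num_radius ip A T * nrmA x ^+ 2.
Proof.
move=> Tc; have [x0|x0] := eqVneq (nrmA x) 0.
  by have := Tc x; rewrite x0 expr0n !mulr0.
have n0 : 0 < nrmA x by rewrite lt_def x0 snorm_ge0.
pose t := (nrmA x)^-1; have t0 : 0 < t by rewrite invr_gt0.
rewrite -ler_pdivrMr ?exprn_gt0//.
apply: ub_le_sup.
  by exists c => _ [y /= y1 <-]; have := Tc y; rewrite [nrmA y]y1 expr1n mulr1.
exists (t%:C%C *: x).
  by rewrite /= -[LHS]/(nrmA _) (snormZ sP) cmodC gtr0_norm// mulVf.
rewrite linearZ_LR (siZl sP) (siZr sP) -/(cmod _) !cmodM cmod_conj.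
by rewrite cmodC gtr0_norm// mulrA -expr2 exprVn mulrC.
Qed.

End NumericalRadius.

(** * Block operators *)

Section BlockOperators.
Variables (R : realType) (V : lmodType R[i]).

Let block_op_is_linear (T11 T12 T21 T22 : {linear V -> V}) :
  linear (block_op T11 T12 T21 T22).
Proof.
move=> a [x1 x2] [y1 y2]; rewrite /block_op/= !linearP.
by congr (_, _); rewrite /= scalerDr addrACA.
Qed.

HB.instance Definition _ (T11 T12 T21 T22 : {linear V -> V}) :=
  GRing.isLinear.Build R[i] (V * V)%type (V * V)%type _
    (block_op T11 T12 T21 T22) (block_op_is_linear T11 T12 T21 T22).

Variables (ip : inner_product V) (A : {linear V -> V}).
Hypothesis sP : semi_inner (semi_ip ip A).
Local Notation sA := (semi_ip ip A).
Local Notation nrmA x := (snorm sA x).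

Let AA := block_op A \0 \0 A.
Local Notation sAA := (semi_ip (dsum_ip ip) AA).
Local Notation nrmAA u := (snorm sAA u).

Lemma semi_ip_diag u v : sAA u v = sA u.1 v.1 + sA u.2 v.2.
Proof. by rewrite /semi_ip /dsum_ip /AA /block_op/= addr0 add0r. Qed.

Lemma semi_inner_diag : semi_inner sAA.
Proof.
split=> [a x y z|x y|x]; rewrite !semi_ip_diag/=.
- by rewrite !(semi_innerPl sP) mulrDr addrACA.
- by rewrite rmorphD/= -!(semi_innerC sP).
- by rewrite addr_ge0// (semi_inner_ge0 sP).
Qed.

(** Parallelogram law: up to the factor 1/2, the coordinates p = u.1 + u.2 and q = u.1 - u.2 are
    orthogonal. *)
Lemma snorm_diag_sqr u : nrmAA u ^+ 2 =
  (nrmA (u.1 + u.2) ^+ 2 + nrmA (u.1 - u.2) ^+ 2) / 2.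
Proof.
rewrite (snorm_sqr semi_inner_diag) semi_ip_diag raddfD/= -!(snorm_sqr sP).
by rewrite (snormD_sqr sP) (snormB_sqr sP); field.
Qed.

Variables T1 T2 : {linear V -> V}.
Let P : {linear V -> V} := T1 \- T2.
Let Q : {linear V -> V} := T1 \+ T2.
Let T : {linear (V * V)%type -> (V * V)%type} := block_op T1 T2 (\- T2) (\- T1).

Lemma block_sum u : (T u).1 + (T u).2 = P (u.1 - u.2).
Proof.
rewrite /T /P /block_op/= !linearB/= opprK addrACA [RHS]addrACA.
by rewrite [- T1 u.2 + _]addrC.
Qed.

Lemma block_diff u : (T u).1 - (T u).2 = Q (u.1 + u.2).
Proof.
rewrite /T /Q /block_op/= !linearD/= !opprK addrACA [RHS]addrACA.
by rewrite [T1 u.2 + _]addrC.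
Qed.

Lemma block_snorm_le (a : R) u : 0 <= a ->
    (forall x, nrmA (P x) <= a * nrmA x) ->
    (forall x, nrmA (Q x) <= a * nrmA x) ->
  nrmAA (T u) <= a * nrmAA u.
Proof.
move=> a0 Pa Qa.
rewrite -ler_sqr ?nnegrE ?mulr_ge0 ?snorm_ge0// exprMn !snorm_diag_sqr.
rewrite block_sum block_diff mulrA ler_pM2r ?invr_gt0// mulrDr addrC -!exprMn.
by rewrite lerD// ler_sqr ?nnegrE ?mulr_ge0 ?snorm_ge0.
Qed.

(** In the coordinates p and q, the square of [T] is diagonal with entries P Q and Q P. *)
Lemma block_sqr_snorm_le (b : R) u : 0 <= b ->
    (forall x, nrmA (P (Q x)) <= b * nrmA x) ->
    (forall x, nrmA (Q (P x)) <= b * nrmA x) ->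
  nrmAA (T (T u)) <= b * nrmAA u.
Proof.
move=> b0 PQb QPb.
rewrite -ler_sqr ?nnegrE ?mulr_ge0 ?snorm_ge0// exprMn !snorm_diag_sqr.
rewrite !(block_sum, block_diff).
rewrite mulrA ler_pM2r ?invr_gt0// mulrDr -!exprMn.
by rewrite lerD// ler_sqr ?nnegrE ?mulr_ge0 ?snorm_ge0.
Qed.

Lemma block_adjoint (X1 X2 : V -> V) u v :
    (forall x y, sA (T1 x) y = sA x (X1 y)) ->
    (forall x y, sA (T2 x) y = sA x (X2 y)) ->
  sAA (T u) v = sAA u (block_op X1 (\- X2) X2 (\- X1) v).
Proof.
move=> adj1 adj2; rewrite !semi_ip_diag /T /block_op/=.
rewrite !(siDl sP) !(siDr sP) !(siNl sP) !(siNr sP) !adj1 !adj2; ring.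
Qed.

Lemma block_diag x : T (x, x) = (Q x, - Q x).
Proof. by congr (_, _); rewrite /Q /= opprD addrC. Qed.

Lemma block_antidiag x : T (x, - x) = (P x, P x).
Proof.
by congr (_, _); rewrite /P /= linearN// opprK addrC.
Qed.

(** (x, x) has q = 0 and (x, -x) has p = 0; [T] swaps the two kinds of vectors, so two steps apply P
    Q. *)
Lemma iter_block_diag n x : iter (2 * n) T (x, x) =
  (iter n (P \o Q) x, iter n (P \o Q) x).
Proof.
elim: n => [//|n IHn].
by rewrite mulnS !iterS IHn block_diag block_antidiag.
Qed.

Lemma iter_block_antidiag n x : iter (2 * n) T (x, - x) =
  (iter n (Q \o P) x, - iter n (Q \o P) x).
Proof.
elim: n => [//|n IHn].
by rewrite mulnS !iterS IHn block_antidiag block_diag.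
Qed.

(** Test the power inequality on (x, x) and (x, -x): the form and the squared seminorm both double,
    and the factor 2 cancels. *)
Lemma num_radius_iter_block_le (w : R) n : 0 <= w ->
    (forall u, cmod (sAA (T u) u) <= w * nrmAA u ^+ 2) ->
  num_radius ip A (iter n (P \o Q)) <= w ^+ (2 * n) /\
  num_radius ip A (iter n (Q \o P)) <= w ^+ (2 * n).
Proof.
move=> w0 Tw; have wn0 : 0 <= w ^+ (2 * n) by rewrite exprn_ge0.
have two (y x : V) : cmod (sA y x + sA y x) = 2 * cmod (sA y x).
  have -> : sA y x + sA y x = (1 + 1)%:C%C * sA y x.
    by rewrite rmorphD/= mulrDl mul1r.
  by rewrite cmodM cmodC ger0_norm.
have Tn u := power_inequality semi_inner_diag (2 * n) u w0 Tw.
split; apply: (num_radius_le wn0) => x.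
- have := Tn (x, x); rewrite iter_block_diag semi_ip_diag snorm_diag_sqr/=.
  rewrite subrr (snorm0 sP) two (snormD_sqr sP).
  rewrite -(snorm_sqr sP) => le; rewrite -(ler_pM2l (ltr0n R 2)).
  apply: le_trans le _.
  by move: (w ^+ _) => W; lra.
- have := Tn (x, - x); rewrite iter_block_antidiag semi_ip_diag snorm_diag_sqr/=.
  rewrite subrr (snorm0 sP) opprK (siNl sP) (siNr sP) opprK.
  rewrite two (snormD_sqr sP).
  rewrite -(snorm_sqr sP) => le; rewrite -(ler_pM2l (ltr0n R 2)).
  apply: le_trans le _.
  by move: (w ^+ _) => W; lra.
Qed.

End BlockOperators.

Theorem theorem3p6 (R : realType) (H : completeNormedModType R[i])
    (ip : inner_product H) (ip_norm : forall x : H, ip x x = `|x| ^+ 2)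
    (A : {linear H -> H}) (A_bounded : bounded_op A)
    (A_positive : positive_op ip A)
    (T1 T2 : {linear H -> H}) (hT1 : LA ip A T1) (hT2 : LA ip A T2) :
  let AA := block_op A \0 \0 A in
  let T := block_op T1 T2 (\- T2) (\- T1) in
  (forall n : nat, (0 < n)%N ->
     num_radius (dsum_ip ip) AA T >=
       Num.max
         (num_radius ip A (iter n ((T1 \- T2) \o (T1 \+ T2))))
         (num_radius ip A (iter n ((T1 \+ T2) \o (T1 \- T2))))
       `^ (2 * n)%:R^-1) /\
  num_radius (dsum_ip ip) AA T <=
    Num.max (op_seminorm ip A (T1 \+ T2)) (op_seminorm ip A (T1 \- T2)) / 2 +
    Num.sqrt (Num.max
      (op_seminorm ip A ((T1 \+ T2) \o (T1 \- T2)))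
      (op_seminorm ip A ((T1 \- T2) \o (T1 \+ T2)))) / 2.
Proof.
move=> AA T; have sP := semi_inner_semi_ip A_positive.
have sAAP := semi_inner_diag sP.
(* These constants serve only to make the suprema finite; the final bounds do not involve them. *)
have [M1 M10 T1M] := LA_bounded ip_norm A_positive hT1.
have [M2 M20 T2M] := LA_bounded ip_norm A_positive hT2.
have [X1 [adj1 _]] := LA_adjoint ip_norm A_positive hT1.
have [X2 [adj2 _]] := LA_adjoint ip_norm A_positive hT2.
pose P : {linear H -> H} := T1 \- T2; pose Q : {linear H -> H} := T1 \+ T2.
pose nA x := snorm (semi_ip ip A) x.
have PM x : nA (P x) <= (M1 + M2) * nA x.
  apply: le_trans (snormD sP (T1 x) (- T2 x)) _.
  by rewrite (snormN sP) mulrDl lerD.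
have QM x : nA (Q x) <= (M1 + M2) * nA x.
  by rewrite mulrDl (le_trans (snormD sP _ _))// lerD.
have M0 : 0 <= M1 + M2 by rewrite addr_ge0.
have PQM x : nA ((P \o Q) x) <= (M1 + M2) ^+ 2 * nA x.
  by rewrite expr2 -mulrA (le_trans (PM _))// ler_wpM2l.
have QPM x : nA ((Q \o P) x) <= (M1 + M2) ^+ 2 * nA x.
  by rewrite expr2 -mulrA (le_trans (QM _))// ler_wpM2l.
set a := Num.max (op_seminorm _ _ _) _.
set b2 := Num.max _ _; set b := Num.sqrt b2.
have a0 : 0 <= a by rewrite le_max op_seminorm_ge0.
have b20 : 0 <= b2 by rewrite le_max op_seminorm_ge0.
have b0 : 0 <= b := sqrtr_ge0 _.
have le_snorm (c d x y : R) : 0 <= x -> c <= d -> y <= c * x -> y <= d * x.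
  by move=> x0 cd /le_trans; apply; rewrite ler_wpM2r.
have nA0 x : 0 <= nA x := snorm_ge0 _ x.
have Pa x : nA (P x) <= a * nA x.
  apply: le_snorm (op_seminormP ip_norm A_bounded A_positive PM x) => //.
  by rewrite le_max lexx orbT.
have Qa x : nA (Q x) <= a * nA x.
  apply: le_snorm (op_seminormP ip_norm A_bounded A_positive QM x) => //.
  by rewrite le_max lexx.
have PQb x : nA (P (Q x)) <= b ^+ 2 * nA x.
  rewrite sqr_sqrtr//.
  apply: le_snorm (op_seminormP ip_norm A_bounded A_positive PQM x) => //.
  by rewrite le_max lexx orbT.
have QPb x : nA (Q (P x)) <= b ^+ 2 * nA x.
  rewrite sqr_sqrtr//.
  apply: le_snorm (op_seminormP ip_norm A_bounded A_positive QPM x) => //.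
  by rewrite le_max lexx.
have upper u : cmod (semi_ip (dsum_ip ip) AA (T u) u) <=
    (a + b) / 2 * snorm (semi_ip (dsum_ip ip) AA) u ^+ 2.
  apply: (num_range_le sAAP _ _ a0 b0) => [x y|x|x].
  - exact: (block_adjoint sP _ _ adj1 adj2).
  - exact: (block_snorm_le sP _ a0 Pa Qa).
  - exact: (block_sqr_snorm_le sP _ (sqr_ge0 b) PQb QPb).
split=> [n n0|]; last first.
  by rewrite -mulrDl; apply: num_radius_le upper; rewrite divr_ge0// addr_ge0.
set w := num_radius _ AA T; have w0 : 0 <= w := num_radius_ge0 _ _ _.
(* The upper bound also shows that the supremum defining [w] is finite, so [w] itself bounds the
   form. *)
have [PQw QPw] := num_radius_iter_block_le sP n w0
  (fun u => num_radiusP sAAP (T := T) u upper).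
(* Write w as (w^(2n))^(1/(2n)) and use monotonicity of the root. *)
rewrite -[leRHS](powRr1 w0) -[X in _ <= w `^ X](@divff _ (2 * n)%:R).
  rewrite powRrM powR_mulrn// ge0_ler_powR ?invr_ge0// ?nnegrE ?exprn_ge0//.
    by rewrite le_max num_radius_ge0.
  by rewrite ge_max PQw.
by rewrite pnatr_eq0 muln_eq0 -lt0n n0.
Qed.
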